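(* Let $v_1,v_2,\dots,v_n$ be a sequence of real numbers, not necessarily distinct. Let $i,j$ be indices with $1\le i<j-1$ and $j\le n$ (for the voucher cost, the index $i=0$ with $v_0=1$ is also allowed). Consider the sequence obtained from $v_1,\dots,v_n$ by reversing the subsequence $v_{i+1},v_{i+2},\dots,v_{j-1}$, that is, \[v_1,\dots,v_i,\ v_{j-1},v_{j-2},\dots,v_{i+1},\ v_j,v_{j+1},\dots,v_n.\] If $(v_i-v_j)(v_{i+1}-v_{j-1})<0$, then the loop, pairwise, and voucher costs of the new sequence are each greater than those of the original sequence. If $(v_i-v_j)(v_{i+1}-v_{j-1})>0$, then these costs of the new sequence are each smaller than those of the original sequence. If $(v_i-v_j)(v_{i+1}-v_{j-1})=0$, then these costs remain unchanged.
   Context: For a sequence $\vec v=(v_1,\dots,v_n)$ of real numbers: the voucher cost is $C_V(\vec v)=v_1+v_1v_2+v_2v_3+\cdots+v_{n-1}v_n=\sum_{i=1}^n v_{i-1}v_i$ with the convention $v_0=1$; for $n\ge2$, the pairwise cost is $C_P(\vec v)=v_1v_2+v_2v_3+\cdots+v_{n-1}v_n$, and the loop cost is $C_L(\vec v)=v_1v_2+v_2v_3+\cdots+v_{n-1}v_n+v_nv_1$. *)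

(* Defs.v *)
From mathcomp Require Import all_boot all_order all_algebra.
From mathcomp Require Import reals.

Set Implicit Arguments.
Unset Strict Implicit.
Unset Printing Implicit Defensive.

Import Order.TTheory GRing.Theory Num.Theory.
Local Open Scope ring_scope.

(* A sequence (v_1, ..., v_n) is an [s : seq R] with n = size s.  [entry s k] is
   v_k in the 1-based indexing, extended by the convention v_0 = 1; only indices
   k <= size s are meaningful. *)
Definition entry (R : realType) (s : seq R) (k : nat) : R := (1 :: s)`_k.

Definition voucher_cost (R : realType) (s : seq R) : R :=
  \sum_(1 <= k < (size s).+1) entry s k.-1 * entry s k.

(* The pairwise and loop costs are only meaningful when 2 <= size s. *)
Definition pairwise_cost (R : realType) (s : seq R) : R :=
  \sum_(1 <= k < size s) entry s k * entry s k.+1.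

Definition loop_cost (R : realType) (s : seq R) : R :=
  pairwise_cost s + entry s (size s) * entry s 1.

(* v_1, ..., v_i, v_(j-1), ..., v_(i+1), v_j, ..., v_n  (for i < j - 1, j <= n):
   in the 0-based indexing of [seq], the 1-based positions i+1, ..., j-1 are
   those dropped by [drop i] from the prefix of length j-1. *)
Definition reverse_between (R : realType) (i j : nat) (s : seq R) : seq R :=
  take i s ++ rev (drop i (take j.-1 s)) ++ drop j.-1 s.

(* Main.v *)
(** Reversing the block v_(i+1), ..., v_(j-1) keeps every product of neighbours
    inside and outside the block and only exchanges v_i v_(i+1) + v_(j-1) v_j for
    v_i v_(j-1) + v_(i+1) v_j, so each cost drops by exactly
    (v_i - v_j)(v_(i+1) - v_(j-1)). *)

Require Import Defs.
From mathcomp Require Import all_boot all_order all_algebra.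
From mathcomp Require Import reals.
From mathcomp Require Import zify ring lra.

Import Order.TTheory GRing.Theory Num.Theory.
Local Open Scope ring_scope.

(** Keeping the starting value separate lets one function serve all costs: it starts at $v_0 = 1$
    for the voucher cost and at $v_1$ for the pairwise cost, to which the loop cost adds a closing
    product. *)
Fixpoint path_cost {R : realType} (x : R) (s : seq R) : R :=
  if s is y :: s' then x * y + path_cost y s' else 0.

Lemma path_costE (R : realType) (x : R) (s : seq R) :
  path_cost x s = \sum_(0 <= k < size s) (x :: s)`_k * s`_k.
Proof.
by elim: s x => [|y s IHs] x /=; rewrite ?big_nil // big_nat_recl //= IHs.
Qed.

Lemma path_cost_cat (R : realType) (x : R) (s t : seq R) :
  path_cost x (s ++ t) = path_cost x s + path_cost (last x s) t.
Proof. by elim: s x => [|y s IHs] x /=; rewrite ?add0r // IHs addrA. Qed.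

(** Since [x :: s] is [belast x s] followed by [last x s], the left side walks the same path
    backwards, and each product of neighbours is symmetric. *)
Lemma path_cost_rev (R : realType) (x : R) (s : seq R) :
  path_cost (last x s) (rev (belast x s)) = path_cost x s.
Proof.
elim: s x => [|y s IHs] x //=.
rewrite rev_cons -cats1 path_cost_cat IHs /= addr0 addrC; congr (_ + _).
(* What remains is that the reversed tail ends in [y], so that the last step goes from [y] to
   [x]. *)
by case: s {IHs} => [|z s] /=; rewrite ?rev_cons ?last_rcons mulrC.
Qed.

Lemma voucher_costE (R : realType) (s : seq R) :
  voucher_cost s = path_cost 1 s.
Proof. by rewrite /voucher_cost big_add1 path_costE. Qed.

Lemma pairwise_cost_cons (R : realType) (x : R) (s : seq R) :
  pairwise_cost (x :: s) = path_cost x s.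
Proof. by rewrite /pairwise_cost big_add1 path_costE. Qed.

Lemma loop_cost_cons (R : realType) (x : R) (s : seq R) :
  loop_cost (x :: s) = path_cost x s + last x s * x.
Proof.
by rewrite /loop_cost pairwise_cost_cons /entry; congr (_ + _ * _); apply: nth_last.
Qed.

Lemma path_cost_rev_block (R : realType) (p b y : R) (a m c : seq R) :
  path_cost p (a ++ rev (b :: m) ++ y :: c) =
  path_cost p (a ++ (b :: m) ++ y :: c) - (last p a - y) * (b - last b m).
Proof.
have last_rev : last (last b m) (rev (belast b m)) = b.
  by case: m => [|z m] //=; rewrite rev_cons last_rcons.
(* Exposing the last element of the block makes its reversal start with [last b m], the form
   [path_cost_rev] expects; [-lastI] then restores the unreversed block. *)
rewrite [b :: m]lastI rev_rcons -lastI !path_cost_cat /=.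
rewrite path_cost_rev last_rev; ring.
Qed.

(** The bounds on [i] and [j] make the block and the tail nonempty, so [b] and [y] exist. Writing
    $v_i$ as [last 1 a] also covers $i = 0$, where [a] is empty and $v_0 = 1$. *)
Lemma reverse_between_split (R : realType) (v : seq R) (i j : nat) :
  (i < j.-1)%N -> (j <= size v)%N ->
  exists a b m y c,
    [/\ v = a ++ (b :: m) ++ y :: c,
        reverse_between i j v = a ++ rev (b :: m) ++ y :: c,
        size a = i
      & [/\ entry v i = last 1 a, entry v i.+1 = b,
            entry v j.-1 = last b m & entry v j = y]].
Proof.
(* From here on [j] is the original index minus one, hence the 0-based position of the entry [y]. *)
case: j => [|j] //= lt_ij lt_jn; rewrite /reverse_between /=.
set a := take i v; set M := drop i (take j v).
have le_iv : (i <= size v)%N by lia.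
have size_a : size a = i by rewrite size_takel.
have size_M : size M = (j - i)%N by rewrite size_drop size_takel // ltnW.
have aM : a ++ M = take j v.
  by rewrite /a -[take i v](@take_takel _ i j) ?cat_take_drop // ltnW.
have dE : drop j v = v`_j :: drop j.+1 v by rewrite (drop_nth 0).
have vE : v = a ++ M ++ drop j v by rewrite catA aM cat_take_drop.
case ME : M size_M => [|b m] /= size_M; first lia.
exists a, b, m, v`_j, (drop j.+1 v); rewrite -dE; split=> //.
  by rewrite {1}vE ME.
have last_a (s : seq R) : (1 :: a ++ s)`_i = last 1 a.
  by rewrite -cat_cons nth_cat /= size_a ltnS leqnn -size_a; apply: nth_last.
have jE : j = (i + (size m).+1)%N by lia.
rewrite /entry; split=> //=.
- by rewrite vE last_a.
- by rewrite vE ME nth_cat size_a ltnn subnn.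
- rewrite vE ME -cat_cons nth_cat /= size_a jE addnS ltnNge ltnS leq_addr /=.
  rewrite subSS addKn -cat_cons nth_cat /= ltnS leqnn; exact: nth_last.
Qed.

Theorem lemma4 (R : realType) (v : seq R) (i j : nat)
    (lt_ij : (i < j.-1)%N) (le_jn : (j <= size v)%N) :
  let w := reverse_between i j v in
  let d := (entry v i - entry v j) * (entry v i.+1 - entry v j.-1) in
  [/\ d < 0 ->
        voucher_cost w > voucher_cost v /\
        ((1 <= i)%N -> pairwise_cost w > pairwise_cost v /\
                       loop_cost w > loop_cost v),
      d > 0 ->
        voucher_cost w < voucher_cost v /\
        ((1 <= i)%N -> pairwise_cost w < pairwise_cost v /\
                       loop_cost w < loop_cost v)
    & d = 0 ->
        voucher_cost w = voucher_cost v /\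
        ((1 <= i)%N -> pairwise_cost w = pairwise_cost v /\
                       loop_cost w = loop_cost v)].
Proof.
have [a [b [m [y [c [vE wE size_a [-> -> -> ->]]]]]]] :=
  reverse_between_split R v i j lt_ij le_jn.
move=> w d.
have voucherE : voucher_cost w = voucher_cost v - d.
  by rewrite /w wE vE !voucher_costE path_cost_rev_block.
have cyclicE : (1 <= i)%N ->
    pairwise_cost w = pairwise_cost v - d /\ loop_cost w = loop_cost v - d.
  (* As $i \ge 1$, the prefix [a] is nonempty and its head $v_1$ serves as starting value. The last
     entry lies in [y :: c], so reversal leaves the closing product $v_n v_1$ unchanged. *)
  rewrite /d /w wE vE -size_a; case: (a) => [|p a'] //= _.
  rewrite !pairwise_cost_cons !loop_cost_cons path_cost_rev_block.
  by rewrite !last_cat /= !last_cat /= addrAC.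
split=> hd; (split; last by move=> /cyclicE [-> ->]; split; lra);
  by rewrite voucherE; lra.
Qed.
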